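(* Assume $L^{\top}x\neq0$ for the statement on $\kappa_\infty^{\mathrm{rel}}$, and that all components of $L^{\top}x$ are nonzero for the statement on $\kappa_c$. Then $$\tfrac12\,\kappa_\infty^{\mathrm U}\le\kappa_\infty^{\mathrm{rel}}\le\kappa_\infty^{\mathrm U},\qquad \tfrac12\,\kappa_c^{\mathrm U}\le\kappa_c\le\kappa_c^{\mathrm U},$$ where, with $H=\big[e_1(\Sigma_{pq}r)^{\top}-x_1A^{\top}\Sigma_{pq},\ \dots,\ e_n(\Sigma_{pq}r)^{\top}-x_nA^{\top}\Sigma_{pq}\big]\in\mathbb R^{n\times mn}$, \begin{align*} \kappa_\infty^{\mathrm U}&=\frac{\big\|L^{\top}R^{-1}U^{-1}U^{-\top}R^{-\top}H D_A\big\|_\infty}{\|L^{\top}x\|_\infty}+\frac{\big\|L^{\top}R^{-1}U^{-1}U^{-\top}R^{-\top}A^{\top}\Sigma_{pq}D_b\big\|_\infty}{\|L^{\top}x\|_\infty},\\ \kappa_c^{\mathrm U}&=\big\|D_{L^{\top}x}^{-1}L^{\top}R^{-1}U^{-1}U^{-\top}R^{-\top}H D_A\big\|_\infty+\big\|D_{L^{\top}x}^{-1}L^{\top}R^{-1}U^{-1}U^{-\top}R^{-\top}A^{\top}\Sigma_{pq}D_b\big\|_\infty . \end{align*}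
   Context: Let $m\ge n$, $p+q=m$, $\Sigma_{pq}=\begin{pmatrix} I_p&0\\0&-I_q\end{pmatrix}$, $A\in\mathbb R^{m\times n}$, $b\in\mathbb R^m$, with $A^{\top}\Sigma_{pq}A$ positive definite (standing assumption; it implies that $A$ has full column rank). Let $x=(x_1,\dots,x_n)^{\top}=(A^{\top}\Sigma_{pq}A)^{-1}A^{\top}\Sigma_{pq}b$ be the solution of the indefinite least squares problem $\min_x(b-Ax)^{\top}\Sigma_{pq}(b-Ax)$, $r=b-Ax$, and let $L\in\mathbb R^{n\times k}$, $k\le n$, be a fixed matrix. QR–Cholesky factors: $A=QR$ with $Q\in\mathbb R^{m\times n}$ having orthonormal columns and $R\in\mathbb R^{n\times n}$ upper triangular and nonsingular; $Q=\begin{pmatrix}Q_1\\Q_2\end{pmatrix}$ with $Q_1\in\mathbb R^{p\times n}$, $Q_2\in\mathbb R^{q\times n}$; and $Q_1^{\top}Q_1-Q_2^{\top}Q_2=U^{\top}U$ is the Cholesky factorization ($U\in\mathbb R^{n\times n}$ upper triangular and nonsingular), so that $A^{\top}\Sigma_{pq}A=R^{\top}U^{\top}UR$. Notation: $W=(A^{\top}\Sigma_{pq}A)^{-1}A^{\top}\Sigma_{pq}$; $e_j$ is the $j$th column of $I_n$; $A(:,j)$ is the $j$th column of $A$; $\mathrm{vec}$ stacks the columns of a matrix; $D_A=\mathrm{diag}(\mathrm{vec}(A))$; $D_v=\mathrm{diag}(v)$ for a vector $v$; $|\cdot|$ of a matrix or vector is entrywise; $\|\cdot\|_\infty$ of a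 matrix is the induced infinity norm. The relative mixed condition number and the componentwise condition number of $g(A,b)=L^{\top}(A^{\top}\Sigma_{pq}A)^{-1}A^{\top}\Sigma_{pq}b$ are $$\kappa_\infty^{\mathrm{rel}}=\frac{\Big\|\sum_{j=1}^n\big|L^{\top}(A^{\top}\Sigma_{pq}A)^{-1}(e_j(\Sigma_{pq}r)^{\top}-x_jA^{\top}\Sigma_{pq})\big|\,|A(:,j)|+|L^{\top}W|\,|b|\Big\|_\infty}{\|L^{\top}x\|_\infty},$$ $$\kappa_c=\Big\|\sum_{j=1}^n\big|D_{L^{\top}x}^{-1}L^{\top}(A^{\top}\Sigma_{pq}A)^{-1}(e_j(\Sigma_{pq}r)^{\top}-x_jA^{\top}\Sigma_{pq})\big|\,|A(:,j)|+|D_{L^{\top}x}^{-1}L^{\top}W|\,|b|\Big\|_\infty .$$ *)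

(* Defs.v *)
From HB Require Import structures.
From mathcomp Require Import all_boot all_order all_algebra.
From mathcomp Require Import all_classical all_reals all_analysis.
Import Order.TTheory GRing.Theory Num.Theory.
Import numFieldNormedType.Exports.

Set Implicit Arguments.
Unset Strict Implicit.
Unset Printing Implicit Defensive.

Local Open Scope classical_set_scope.
Local Open Scope ring_scope.

Section MatrixNotions.
Variable K : realType.

Definition posdefmx n (M : 'M[K]_n) : Prop :=
  M^T = M /\ forall v : 'cV[K]_n, v != 0 -> 0 < (v^T *m M *m v) 0 0.

(* [is_trig_mx] is the lower triangular predicate. *)
Definition upper_trig_mx n (M : 'M[K]_n) : bool := is_trig_mx M^T.

Definition absmx m n (M : 'M[K]_(m, n)) : 'M[K]_(m, n) :=
  map_mx (fun a : K => `|a|) M.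

(* The library norm [`|v|] of a column vector is its infinity norm.  On a
   general matrix [`|M|] is the largest modulus of an entry, so the operator
   norm induced by the vector infinity norm is defined separately. *)
Definition norm_inf m n (M : 'M[K]_(m, n)) : K :=
  sup [set `|M *m v| | v in [set v : 'cV[K]_n | `|v| <= 1]].

Definition Dvec n (v : 'cV[K]_n) : 'M[K]_n := diag_mx v^T.

(* The library's [mxvec] stacks rows.  Here the columns are stacked, so the
   dimension is the sum of [n] copies of [m], i.e. [m * n]. *)
Definition vec m n (A : 'M[K]_(m, n)) : 'cV[K]_(\sum_(j < n) m) :=
  \mxcol_(j < n) col j A.

Definition Sigma p q : 'M[K]_(p + q) := block_mx 1%:M 0 0 (- 1%:M).

End MatrixNotions.

Arguments Sigma {K} p q.

Section ILS.
Variables (K : realType) (p q n : nat).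
Variables (A : 'M[K]_(p + q, n)) (b : 'cV[K]_(p + q)).

Definition gram : 'M[K]_n := A^T *m Sigma p q *m A.

Definition ilsW : 'M[K]_(n, p + q) := invmx gram *m A^T *m Sigma p q.

Definition ils_sol : 'cV[K]_n := ilsW *m b.

Definition ils_res : 'cV[K]_(p + q) := b - A *m ils_sol.

Definition Hblock (j : 'I_n) : 'M[K]_(n, p + q) :=
  delta_mx j 0 *m (Sigma p q *m ils_res)^T
  - ils_sol j 0 *: (A^T *m Sigma p q).

Definition ilsH : 'M[K]_(n, \sum_(j < n) (p + q)) := \mxrow_(j < n) Hblock j.

Variables (k : nat) (L : 'M[K]_(n, k)).

Definition kappa_inf_rel : K :=
  `| \sum_(j < n) absmx (L^T *m invmx gram *m Hblock j) *m absmx (col j A)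
     + absmx (L^T *m ilsW) *m absmx b |
  / `| L^T *m ils_sol |.

Definition kappa_c : K :=
  let Di := invmx (Dvec (L^T *m ils_sol)) in
  `| \sum_(j < n)
       absmx (Di *m L^T *m invmx gram *m Hblock j) *m absmx (col j A)
     + absmx (Di *m L^T *m ilsW) *m absmx b |.

Variables R U : 'M[K]_n.

Definition LRU : 'M[K]_(k, n) :=
  L^T *m invmx R *m invmx U *m (invmx U)^T *m (invmx R)^T.

Definition kappa_inf_U : K :=
  norm_inf (LRU *m ilsH *m Dvec (vec A)) / `| L^T *m ils_sol |
  + norm_inf (LRU *m A^T *m Sigma p q *m Dvec b) / `| L^T *m ils_sol |.

Definition kappa_c_U : K :=
  let Di := invmx (Dvec (L^T *m ils_sol)) in
  norm_inf (Di *m LRU *m ilsH *m Dvec (vec A))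
  + norm_inf (Di *m LRU *m A^T *m Sigma p q *m Dvec b).

End ILS.

(* Main.v *)
(* The infinity norm of a matrix M is that of the vector |M| 1 of absolute row
   sums.  For M D_v this vector is |M| |v|, so the two norms whose sum is the
   bound are those of the two nonnegative vectors u1, u2 whose sum gives the
   condition number, and |u1|, |u2| <= |u1 + u2| <= |u1| + |u2|. *)
Require Import Defs.
From mathcomp Require Import all_boot all_order all_algebra.
From mathcomp Require Import all_classical all_reals all_analysis.
From mathcomp Require Import lra.
Import Order.TTheory GRing.Theory Num.Theory.
Import numFieldNormedType.Exports.
Local Open Scope ring_scope.

(** The condition [0 <= c] covers [n = 0], where the norm is an empty maximum with value 0. *)
Lemma cV_norm_leP (K : realType) n (v : 'cV[K]_n) (c : K) :
  0 <= c -> (`|v| <= c) <-> (forall i, `|v i 0| <= c).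
Proof.
move=> c0; rewrite [`|v|]/Num.norm /= mx_normrE; split.
  move=> /bigmax_leP[_ le_vc] i.
  exact: (le_vc (i, 0) isT).
by move=> le_vc; apply/bigmax_leP; split=> // -[i j] _; rewrite /= ord1.
Qed.

Lemma absmx_mulmx_const1 (K : realType) m n (M : 'M[K]_(m, n)) i :
  (absmx M *m const_mx 1 : 'cV[K]_m) i 0 = \sum_j `|M i j|.
Proof. by rewrite mxE; apply: eq_bigr => j _; rewrite !mxE mulr1. Qed.

Lemma absmx_mulmx_ge0 (K : realType) m n o (M : 'M[K]_(m, n))
    (N : 'M[K]_(n, o)) i j :
  0 <= (absmx M *m absmx N) i j.
Proof. by rewrite mxE sumr_ge0// => l _; rewrite !mxE mulr_ge0. Qed.

Lemma norm_infE (K : realType) m n (M : 'M[K]_(m, n)) :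
  norm_inf M = `|absmx M *m const_mx 1 : 'cV[K]_m|.
Proof.
have ubM : ubound [set `|M *m v| | v in [set v : 'cV[K]_n | `|v| <= 1]]%classic
    `|absmx M *m const_mx 1 : 'cV[K]_m|.
  move=> _ [v /= /cV_norm_leP-/(_ ler01) v1 <-].
  apply/cV_norm_leP => // i.
  (* Taking [c] to be the norm itself bounds the [i]-th entry by the norm. *)
  have /cV_norm_leP-/(_ (normr_ge0 _) i) := lexx `|absmx M *m const_mx 1 : 'cV[K]_m|.
  apply: le_trans; rewrite absmx_mulmx_const1 mxE.
  apply: le_trans (ler_norm_sum _ _ _) _.
  apply: le_trans (ler_norm _); apply: ler_sum => j _.
  by rewrite normrM ler_piMr.
have supM : has_ubound [set `|M *m v| | v in [set v : 'cV[K]_n | `|v| <= 1]]%classic.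
  by exists `|absmx M *m const_mx 1 : 'cV[K]_m|.
(* The value 0 makes the set nonempty, and it also yields [0 <= norm_inf M], the side condition of
   [cV_norm_leP] below. *)
have mem0 : [set `|M *m v| | v in [set v : 'cV[K]_n | `|v| <= 1]]%classic 0.
  by exists 0; rewrite /= ?mulmx0 normr0.
apply/eqP; rewrite eq_le; apply/andP; split.
  by apply: ge_sup => //; exists 0.
apply/cV_norm_leP; first exact: ub_le_sup.
(* The sign vector of row i attains the i-th absolute row sum. *)
move=> i; pose s : 'cV[K]_n := \col_j Num.sg (M i j).
apply: (@le_trans _ _ `|M *m s|).
  have /cV_norm_leP-/(_ (normr_ge0 _) i) := lexx `|M *m s|.
  apply: le_trans; rewrite absmx_mulmx_const1 mxE.
  by under [in leRHS]eq_bigr => j _ do rewrite mxE mulrC -normrEsg.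
apply: ub_le_sup => //; exists s => //=.
by apply/cV_norm_leP => // j; rewrite mxE normr_sg lern1 leq_b1.
Qed.

Lemma norm_inf_mulmx_Dvec (K : realType) m n (M : 'M[K]_(m, n))
    (v : 'cV[K]_n) :
  norm_inf (M *m Dvec v) = `|absmx M *m absmx v|.
Proof.
rewrite norm_infE; congr `|_|; apply/colP => i.
rewrite absmx_mulmx_const1 mxE; apply: eq_bigr => j _.
by rewrite mul_mx_diag !mxE normrM.
Qed.

(** Absolute values pass to the blocks, and since [vec] stacks columns, the block product pairs
    [B j] with column [j] of [A]. *)
Lemma absmx_mxrow_vec (K : realType) m n k (B : 'I_n -> 'M[K]_(k, m))
    (A : 'M[K]_(m, n)) :
  absmx (\mxrow_j B j) *m absmx (vec A)
  = \sum_j absmx (B j) *m absmx (col j A).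
Proof.
rewrite -mul_mxrow_mxcol; by congr (_ *m _); apply/matrixP => i j; rewrite !mxE.
Qed.

Lemma norm_cV_add_bounds (K : realType) n (u v : 'cV[K]_n) :
  (forall i, 0 <= u i 0) -> (forall i, 0 <= v i 0) ->
  2^-1 * (`|u| + `|v|) <= `|u + v| <= `|u| + `|v|.
Proof.
move=> u0 v0; rewrite ler_normD andbT.
(* The factor 1/2 comes from averaging these two bounds, which hold because nonnegative entries
   cannot cancel. *)
suff [leu lev] : `|u| <= `|u + v| /\ `|v| <= `|u + v| by lra.
have /cV_norm_leP-/(_ (normr_ge0 _)) le_uv := lexx `|u + v|.
split; apply/cV_norm_leP => // i; apply: le_trans (le_uv i); rewrite mxE.
  by rewrite !ger0_norm ?addr_ge0// lerDl.
by rewrite !ger0_norm ?addr_ge0// lerDr.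
Qed.

(** [G] is kept general to serve both condition numbers: it will be [LRU L R U], or that matrix
    scaled on the left by the inverse of the diagonal matrix of [L^T x]. *)
Lemma norm_inf_add_bounds {K : realType} {m n k l : nat} (G : 'M[K]_(l, k))
    (B : 'I_n -> 'M[K]_(k, m)) (C : 'M[K]_(l, m)) (A : 'M[K]_(m, n))
    (b : 'cV[K]_m) :
  let a := norm_inf (G *m (\mxrow_j B j) *m Dvec (vec A))
           + norm_inf (C *m Dvec b) in
  2^-1 * a <= `|\sum_j absmx (G *m B j) *m absmx (col j A)
                + absmx C *m absmx b| <= a.
Proof.
rewrite /= !norm_inf_mulmx_Dvec mul_mxrow absmx_mxrow_vec.
apply: norm_cV_add_bounds => i; last exact: absmx_mulmx_ge0.
by rewrite summxE sumr_ge0// => j _; exact: absmx_mulmx_ge0.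
Qed.

Lemma mulmx_Sigma (K : realType) p q n (Q : 'M[K]_(p + q, n)) :
  Q^T *m Sigma p q *m Q
  = (usubmx Q)^T *m usubmx Q - (dsubmx Q)^T *m dsubmx Q.
Proof.
rewrite -{1 2}(vsubmxK Q) tr_col_mx /Sigma mul_row_block !mulmx0 add0r addr0.
by rewrite mulmx1 mulmxN mulmx1 mul_row_col mulNmx.
Qed.

(** Substituting [A = Q R] and the Cholesky factorization turns the Gram matrix into
    [(U R)^T (U R)], which is inverted factor by factor. *)
Lemma LRUE {K : realType} {p q n k : nat} {A Q : 'M[K]_(p + q, n)} {R U : 'M[K]_n}
    (L : 'M[K]_(n, k)) :
  A = Q *m R -> R \in unitmx -> U \in unitmx ->
  (usubmx Q)^T *m usubmx Q - (dsubmx Q)^T *m dsubmx Q = U^T *m U ->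
  LRU L R U = L^T *m invmx (gram A).
Proof.
move=> A_QR unitR unitU cholU.
have -> : gram A = (U *m R)^T *m (U *m R).
  transitivity (R^T *m (Q^T *m Sigma p q *m Q) *m R).
    by rewrite /gram A_QR trmx_mul !mulmxA.
  by rewrite mulmx_Sigma cholU trmx_mul !mulmxA.
have unitUR : U *m R \in unitmx by rewrite unitmx_mul unitU.
have invUR : invmx (U *m R) = invmx R *m invmx U.
  apply: (can_inj (mulKmx unitUR)); rewrite mulmxV//.
  by rewrite -mulmxA mulKVmx// mulmxV.
have unitGR : (U *m R)^T *m (U *m R) \in unitmx.
  by rewrite unitmx_mul unitmx_tr unitUR.
have -> : LRU L R U = L^T *m (invmx (U *m R) *m (invmx (U *m R))^T).
  by rewrite /LRU invUR trmx_mul !mulmxA.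
(* Left multiplication by the invertible [(U R)^T (U R)] is injective and sends both candidates to
   the identity. *)
congr (_ *m _); apply: (can_inj (mulKmx unitGR)); rewrite mulmxV//.
by rewrite -[LHS]mulmxA mulKVmx// -trmx_mul mulVmx// trmx1.
Qed.

Theorem theorem3 (K : realType) (p q n k : nat)
    (A : 'M[K]_(p + q, n)) (b : 'cV[K]_(p + q)) (L : 'M[K]_(n, k))
    (Q : 'M[K]_(p + q, n)) (R U : 'M[K]_n)
    (le_nm : (n <= p + q)%N) (le_kn : (k <= n)%N)
    (posA : posdefmx (A^T *m Sigma p q *m A))
    (A_QR : A = Q *m R)
    (orthQ : Q^T *m Q = 1%:M)
    (trigR : upper_trig_mx R) (unitR : R \in unitmx)
    (cholU : (usubmx Q)^T *m usubmx Q - (dsubmx Q)^T *m dsubmx Q = U^T *m U)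
    (trigU : upper_trig_mx U) (unitU : U \in unitmx) :
  let y := L^T *m ils_sol A b in
  (y != 0 ->
     2^-1 * kappa_inf_U A b L R U <= kappa_inf_rel A b L
       <= kappa_inf_U A b L R U)
  /\
  ((forall i : 'I_k, y i 0 != 0) ->
     2^-1 * kappa_c_U A b L R U <= kappa_c A b L
       <= kappa_c_U A b L R U).
Proof.
have LRU_gram := LRUE L A_QR unitR unitU cholU.
split=> _.
  rewrite /kappa_inf_U /kappa_inf_rel -mulrDl mulrA.
  have n0 : 0 <= `|L^T *m ils_sol A b|^-1 by rewrite invr_ge0.
  have /andP[lo hi] := norm_inf_add_bounds (LRU L R U) (Hblock A b)
    (LRU L R U *m A^T *m Sigma p q) A b.
  (* The first replacement acts in the sum over [j]; the second acts in [L^T W], once reassociation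
     exposes the same product there. *)
  rewrite /ilsW -LRU_gram !mulmxA -LRU_gram.
  by apply/andP; split; rewrite ler_wpM2r.
rewrite /kappa_c_U /kappa_c /=.
(* The diagonal scaling enters only as a left factor, absorbed into [G] and [C]. *)
set Di := invmx _.
have := norm_inf_add_bounds (Di *m LRU L R U) (Hblock A b)
  (Di *m LRU L R U *m A^T *m Sigma p q) A b.
by rewrite /ilsW LRU_gram !mulmxA.
Qed.
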